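(* On $\mathrm{fGC}_1^{\ge 1}$ it holds that $D^2=0$.
   Context: Let $\mathbb K$ be a field of characteristic zero. $\mathrm{fGC}_1^{\ge i}$ is the space of formal, possibly infinite, $\mathbb K$-linear combinations of isomorphism classes of finite, not necessarily connected graphs with $v\ge1$ vertices and $e\ge0$ edges (multiple edges allowed), without tadpoles (edges from a vertex to itself), all vertices at least $i$-valent, equipped with an ordering of the vertices and a direction of each edge, modulo the relations that permuting the vertex ordering multiplies by the sign of the permutation and reversing the direction of an edge multiplies by $-1$ (edges are unordered). The degree is $v-1$. Deleting a vertex: $D(\Gamma)=\sum_{x\in V(\Gamma)}(-1)^{v(x)}\tilde D_x(\Gamma)$, where $v(x)$ is the valence of $x$ and $\tilde D_x$ deletes the vertex $x$ and sums over all ways of reconnecting the (distinguished) edge-ends that were at $x$ to the other vertices, skipping graphs with a tadpole; edges keep their directions (the end that was at $x$ is moved), and before deletion $x$ is moved to the last place in the vertex ordering. Graphs with no vertices are regarded as zero. *)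

(* Defs.v *)
From HB Require Import structures.
From mathcomp Require Import all_boot all_order perm all_algebra.

Set Implicit Arguments.
Unset Strict Implicit.
Unset Printing Implicit Defensive.

Import GRing.Theory.
Local Open Scope ring_scope.
Local Open Scope quotient_scope.

(* The quotient V / U of a vector space by a subspace, as a K-module: the     *)
(* library provides its additive group, we add the scaling.                   *)
Section VectorQuotient.
Variables (K : fieldType) (V : vectType K) (U : {vspace V}).

Definition vquot : Type := {ideal_quot U}.

HB.instance Definition _ := GRing.Zmodule.on vquot.

Definition vquot_pi (v : V) : vquot := \pi_{ideal_quot U} v.
Definition vquot_repr (q : vquot) : V := repr (q : {ideal_quot U}).

Lemma vquot_reprK : cancel vquot_repr vquot_pi.
Proof. exact: reprK. Qed.

Lemma vquot_eqP u v : reflect (vquot_pi u = vquot_pi v) (u - v \in U).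
Proof. by rewrite Quotient.idealrBE; apply: eqP. Qed.

Lemma vquot_repr_sub v : vquot_repr (vquot_pi v) - v \in U.
Proof. by apply/vquot_eqP; rewrite vquot_reprK. Qed.

Lemma vquot_piB : {morph vquot_pi : u v / u - v}.
Proof. exact: raddfB. Qed.

Lemma vquot_piD : {morph vquot_pi : u v / u + v}.
Proof. exact: raddfD. Qed.

Definition vquot_scale (a : K) (q : vquot) : vquot :=
  vquot_pi (a *: vquot_repr q).

Lemma vquot_piZ a v : vquot_pi (a *: v) = vquot_scale a (vquot_pi v).
Proof.
by apply/esym/vquot_eqP; rewrite -scalerBr rpredZ ?vquot_repr_sub.
Qed.

Fact vquot_scaleA a b q :
  vquot_scale a (vquot_scale b q) = vquot_scale (a * b) q.
Proof. by rewrite -[q]vquot_reprK -!vquot_piZ scalerA. Qed.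

Fact vquot_scale1 : left_id 1 vquot_scale.
Proof. by move=> q; rewrite -[q]vquot_reprK -!vquot_piZ scale1r. Qed.

Fact vquot_scaleDr : right_distributive vquot_scale +%R.
Proof.
move=> a p q; rewrite -[p]vquot_reprK -[q]vquot_reprK.
by rewrite -vquot_piD -!vquot_piZ -vquot_piD scalerDr.
Qed.

Fact vquot_scaleDl q : {morph vquot_scale^~ q : a b / a + b}.
Proof.
by move=> a b; rewrite -[q]vquot_reprK -!vquot_piZ -vquot_piD scalerDl.
Qed.

HB.instance Definition _ := GRing.Zmodule_isLmodule.Build K vquot
  vquot_scaleA vquot_scale1 vquot_scaleDr vquot_scaleDl.

Fact vquot_pi_linear : linear vquot_pi.
Proof. by move=> a u v; rewrite vquot_piD vquot_piZ. Qed.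

HB.instance Definition _ :=
  GRing.isLinear.Build K V vquot *:%R vquot_pi vquot_pi_linear.

End VectorQuotient.

Arguments vquot_repr {K V U} q.

(* The map V / U -> W / U' induced by a map f : V -> W; it is meaningful when *)
(* f is linear and maps U into U'.                                            *)
Definition vquot_map (K : fieldType) (V W : vectType K) (U : {vspace V})
    (U' : {vspace W}) (f : V -> W) (q : vquot U) : vquot U' :=
  vquot_pi U' (f (vquot_repr q)).

Lemma vquot_mapE (K : fieldType) (V W : vectType K) (U : {vspace V})
    (U' : {vspace W}) (f : {linear V -> W}) :
  {in U, forall u, f u \in U'} ->
  forall v, vquot_map U' f (vquot_pi U v) = vquot_pi U' (f v).
Proof.
move=> fU v; apply/vquot_eqP; rewrite -raddfB /=.
exact/fU/vquot_repr_sub.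
Qed.

Section Graphs.

(* The edge-ends of e directed edges: (j, false) is the start of the edge j   *)
(* and (j, true) is its end.                                                  *)
Definition halfedge (e : nat) : finType := ('I_e * bool)%type.

(* A graph is given by the vertex to which each edge-end is attached.  The    *)
(* vertex ordering is the order of 'I_n.  Edges carry labels in 'I_e, which   *)
(* are forgotten by the relations below.                                      *)
Definition pregraph (n e : nat) : finType := {ffun halfedge e -> 'I_n}.

Definition valence n e (g : pregraph n e) (x : 'I_n) : nat :=
  #|[set h | g h == x]|.

Definition tadpole_free n e (g : pregraph n e) : bool :=
  [forall j : 'I_e, g (j, false) != g (j, true)].

Definition min_valence i n e (g : pregraph n e) : bool :=
  [forall x : 'I_n, (i <= valence g x)%N].

Definition graph (i n e : nat) : finType :=
  {g : pregraph n e | tadpole_free g && min_valence i g}.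

(* The vertex at place x in the ordering is moved to place s x.               *)
Definition permute_vertices n e (s : 'S_n) (g : pregraph n e) : pregraph n e :=
  [ffun h => s (g h)].

Definition permute_edges n e (t : 'S_e) (g : pregraph n e) : pregraph n e :=
  [ffun h => g (t h.1, h.2)].

Definition reverse_edge n e (j : 'I_e) (g : pregraph n e) : pregraph n e :=
  [ffun h => g (h.1, (h.1 == j) (+) h.2)].

(* The graph obtained from g by deleting the vertex x and attaching each      *)
(* edge-end h that was at x to r h.  Vertex k of the result is vertex         *)
(* lift x k of g; the value ord0 is never used.                               *)
Definition reconnect n e (g : pregraph n.+2 e) (x : 'I_n.+2)
    (r : {ffun {h | g h == x} -> 'I_n.+1}) : pregraph n.+1 e :=
  [ffun h => if insub h is Some h' then r h' else odflt ord0 (unlift x (g h))].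

Lemma permute_verticesK n e (s : 'S_n) :
  cancel (@permute_vertices n e s) (permute_vertices s^-1).
Proof. by move=> g; apply/ffunP=> h; rewrite !ffunE permK. Qed.

Lemma permute_edgesK n e (t : 'S_e) :
  cancel (@permute_edges n e t) (permute_edges t^-1).
Proof.
by move=> g; apply/ffunP=> -[j b]; rewrite !ffunE /= permKV.
Qed.

Lemma reverse_edgeK n e (j : 'I_e) : involutive (@reverse_edge n e j).
Proof.
by move=> g; apply/ffunP=> -[k b]; rewrite !ffunE /= addbA addbb.
Qed.

Lemma valence_permute_vertices n e (s : 'S_n) (g : pregraph n e) x :
  valence (permute_vertices s g) (s x) = valence g x.
Proof.
by apply: eq_card => h; rewrite !inE ffunE (inj_eq perm_inj).
Qed.

Lemma valence_permute_edges n e (t : 'S_e) (g : pregraph n e) x :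
  valence (permute_edges t g) x = valence g x.
Proof.
have inj: injective (fun h : halfedge e => (t h.1, h.2)).
  by move=> [j b] [k c] [/perm_inj -> ->].
rewrite /valence -(card_imset _ inj); apply: eq_card => -[j b]; rewrite !inE.
apply/imsetP/idP => [[[k c]]|gx]; first by rewrite inE ffunE => gx [-> ->].
by exists (t^-1%g j, b); rewrite ?inE ?ffunE /= permKV.
Qed.

Lemma valence_reverse_edge n e (j : 'I_e) (g : pregraph n e) x :
  valence (reverse_edge j g) x = valence g x.
Proof.
have invo: involutive (fun h : halfedge e => (h.1, (h.1 == j) (+) h.2)).
  by move=> [k b] /=; rewrite addbA addbb.
rewrite /valence -(card_imset _ (inv_inj invo)).
apply: eq_card => h; rewrite !inE.
apply/imsetP/idP => [[k]|gx]; first by rewrite inE ffunE => gx ->.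
exists (h.1, (h.1 == j) (+) h.2); rewrite ?inE ?ffunE /= addbA addbb //.
  by case: h gx.
by case: h gx.
Qed.

Lemma tadpole_free_permute_vertices n e (s : 'S_n) (g : pregraph n e) :
  tadpole_free (permute_vertices s g) = tadpole_free g.
Proof. by apply: eq_forallb => j; rewrite !ffunE (inj_eq perm_inj). Qed.

Lemma tadpole_free_permute_edges n e (t : 'S_e) (g : pregraph n e) :
  tadpole_free (permute_edges t g) = tadpole_free g.
Proof.
apply/forallP/forallP => tg j; last by rewrite !ffunE.
by have := tg (t^-1%g j); rewrite !ffunE /= permKV.
Qed.

Lemma tadpole_free_reverse_edge n e (j : 'I_e) (g : pregraph n e) :
  tadpole_free (reverse_edge j g) = tadpole_free g.
Proof.
apply: eq_forallb => k; rewrite !ffunE /=.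
by case: (k == j); rewrite //= eq_sym.
Qed.

Lemma min_valence_permute_vertices i n e (s : 'S_n) (g : pregraph n e) :
  min_valence i (permute_vertices s g) = min_valence i g.
Proof.
apply/forallP/forallP => vg x; first by have := vg (s x); rewrite valence_permute_vertices.
by rewrite -(permKV s x) valence_permute_vertices.
Qed.

Lemma min_valence_permute_edges i n e (t : 'S_e) (g : pregraph n e) :
  min_valence i (permute_edges t g) = min_valence i g.
Proof. by apply: eq_forallb => x; rewrite valence_permute_edges. Qed.

Lemma min_valence_reverse_edge i n e (j : 'I_e) (g : pregraph n e) :
  min_valence i (reverse_edge j g) = min_valence i g.
Proof. by apply: eq_forallb => x; rewrite valence_reverse_edge. Qed.

(* Reconnecting preserves the valence condition, so that only the graphs with *)
(* a tadpole have to be discarded in the definition of delete_vertex below.   *)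
Lemma min_valence_reconnect i n e (g : pregraph n.+2 e) x r :
  min_valence i g -> min_valence i (@reconnect n e g x r).
Proof.
move=> /forallP vg; apply/forallP => k; apply: leq_trans (vg (lift x k)) _.
apply/subset_leq_card/subsetP => h; rewrite !inE ffunE => /eqP gh.
case: insubP => [h'|_]; first by rewrite gh eq_sym (negbTE (neq_lift x k)).
by rewrite gh liftK.
Qed.

End Graphs.

Section GraphComplex.
Variables (K : fieldType) (i : nat).

(* The free vector space on the labelled graphs with n vertices and e edges.  *)
Definition chain (n e : nat) : vectType K := {ffun graph i n e -> K^o}.

Definition delta n e (G : graph i n e) : chain n e :=
  [ffun G' => (G' == G)%:R].

(* The generator given by g, or zero if g has a tadpole or a vertex of        *)
(* valence less than i.                                                       *)
Definition gen n e (g : pregraph n e) : chain n e :=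
  if insub g is Some G then delta G else 0.

Definition relations n e : {vspace chain n e} :=
  (\sum_(G : graph i n e) \sum_(s : 'S_n)
      <[gen (permute_vertices s (val G)) - (-1) ^+ s *: gen (val G)]>
   + \sum_(G : graph i n e) \sum_(t : 'S_e)
      <[gen (permute_edges t (val G)) - gen (val G)]>
   + \sum_(G : graph i n e) \sum_(j : 'I_e)
      <[gen (reverse_edge j (val G)) + gen (val G)]>)%VS.

(* The span of the isomorphism classes with n vertices and e edges.           *)
Definition fGC_part (n e : nat) : lmodType K := vquot (relations n e).

(* The component x n e of x is its part with n.+1 vertices and e edges, of    *)
(* degree n.  There are finitely many isomorphism classes of graphs for each  *)
(* n and e, so possibly infinite linear combinations of classes are the same  *)
(* as arbitrary families of components.                                       *)
Definition fGC : Type := forall n e : nat, fGC_part n.+1 e.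

(* lift_perm x ord_max 1 moves x to the last place and keeps the order of the *)
(* other vertices; its sign is that of the new ordering.                      *)
Definition delete_vertex n e (g : pregraph n.+2 e) (x : 'I_n.+2) :
    chain n.+1 e :=
  (-1) ^+ lift_perm x ord_max 1%g *:
  \sum_(r : {ffun {h | g h == x} -> 'I_n.+1}) gen (reconnect r).

Definition delete_graph n e (g : pregraph n.+2 e) : chain n.+1 e :=
  \sum_(x : 'I_n.+2) (-1) ^+ valence g x *: delete_vertex g x.

Definition delete_chain n e (c : chain n.+2 e) : chain n.+1 e :=
  \sum_(G : graph i n.+2 e) c G *: delete_graph (val G).

Fact delete_chain_linear n e : linear (@delete_chain n e).
Proof.
move=> a c d; rewrite /delete_chain scaler_sumr -big_split /=.
by apply: eq_bigr => G _; rewrite !ffunE scalerDl scalerA.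
Qed.

HB.instance Definition _ n e :=
  GRing.isLinear.Build K (chain n.+2 e) (chain n.+1 e) *:%R (@delete_chain n e)
    (@delete_chain_linear n e).

(* The lemmas up to delete_chain_relations show that delete_chain preserves   *)
(* the relations, so that it induces a map between the quotients.             *)

Lemma gen_val n e (G : graph i n e) : gen (val G) = delta G.
Proof. by rewrite /gen valK. Qed.

Lemma gen_out n e (g : pregraph n e) :
  ~~ (tadpole_free g && min_valence i g) -> gen g = 0.
Proof. by move=> Ng; rewrite /gen insubN. Qed.

Lemma delete_chain_delta n e (G : graph i n.+2 e) :
  delete_chain (delta G) = delete_graph (val G).
Proof.
rewrite /delete_chain (bigD1 G) //= big1 => [|H /negbTE nHG].
  by rewrite ffunE eqxx scale1r addr0.
by rewrite ffunE nHG scale0r.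
Qed.

Lemma relation_permute_vertices n e (s : 'S_n) (g : pregraph n e) :
  gen (permute_vertices s g) - (-1) ^+ s *: gen g \in relations n e.
Proof.
have [Gg|Ng] := boolP (tadpole_free g && min_valence i g); last first.
  rewrite !gen_out ?scaler0 ?subr0 ?mem0v //.
  by rewrite tadpole_free_permute_vertices min_valence_permute_vertices.
apply: (subvP (addvSl _ _)); apply: (subvP (addvSl _ _)).
have sub : (<[gen (permute_vertices s g) - (-1) ^+ s *: gen g]> <=
   \sum_(G : graph i n e) \sum_(s : 'S_n)
     <[gen (permute_vertices s (val G)) - (-1) ^+ s *: gen (val G)]>)%VS.
  by apply: (sumv_sup (Sub g Gg : graph i n e)) => //; apply: (sumv_sup s).
by apply: (subvP sub); apply: memv_line.
Qed.

Lemma relation_permute_edges n e (t : 'S_e) (g : pregraph n e) :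
  gen (permute_edges t g) - gen g \in relations n e.
Proof.
have [Gg|Ng] := boolP (tadpole_free g && min_valence i g); last first.
  rewrite !gen_out ?subr0 ?mem0v //.
  by rewrite tadpole_free_permute_edges min_valence_permute_edges.
apply: (subvP (addvSl _ _)); apply: (subvP (addvSr _ _)).
have sub : (<[gen (permute_edges t g) - gen g]> <=
   \sum_(G : graph i n e) \sum_(t : 'S_e)
     <[gen (permute_edges t (val G)) - gen (val G)]>)%VS.
  by apply: (sumv_sup (Sub g Gg : graph i n e)) => //; apply: (sumv_sup t).
by apply: (subvP sub); apply: memv_line.
Qed.

Lemma relation_reverse_edge n e (j : 'I_e) (g : pregraph n e) :
  gen (reverse_edge j g) + gen g \in relations n e.
Proof.
have [Gg|Ng] := boolP (tadpole_free g && min_valence i g); last first.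
  rewrite !gen_out ?addr0 ?mem0v //.
  by rewrite tadpole_free_reverse_edge min_valence_reverse_edge.
apply: (subvP (addvSr _ _)).
have sub : (<[gen (reverse_edge j g) + gen g]> <=
   \sum_(G : graph i n e) \sum_(j : 'I_e)
     <[gen (reverse_edge j (val G)) + gen (val G)]>)%VS.
  by apply: (sumv_sup (Sub g Gg : graph i n e)) => //; apply: (sumv_sup j).
by apply: (subvP sub); apply: memv_line.
Qed.

Definition reconnects n e (g : pregraph n.+2 e) x (g' : pregraph n.+1 e) :=
  [forall h, (g h == x) || (g h == lift x (g' h))].

Lemma reconnectsP n e (g : pregraph n.+2 e) x (g' : pregraph n.+1 e) :
  reflect (forall h, g h != x -> g h = lift x (g' h)) (reconnects g x g').
Proof.
apply: (iffP forallP) => [rg h /negbTE gh|rg h].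
  by have := rg h; rewrite gh => /eqP.
by case: eqVneq => //= gh; rewrite {1}(rg h gh).
Qed.

Lemma sum_reconnect n e (g : pregraph n.+2 e) x (W : zmodType)
    (F : pregraph n.+1 e -> W) :
  \sum_(r : {ffun {h | g h == x} -> 'I_n.+1}) F (reconnect r) =
  \sum_(g' | reconnects g x g') F g'.
Proof.
pose restr (g' : pregraph n.+1 e) : {ffun {h | g h == x} -> 'I_n.+1} :=
  [ffun h => g' (val h)].
rewrite [RHS](reindex_onto (@reconnect n e g x) restr) => [|g' /reconnectsP rg].
  apply: eq_bigl => r; apply/esym/andP; split.
    apply/reconnectsP=> h gh; rewrite ffunE.
    case: insubP => [h'|_]; first by rewrite (negbTE gh).
    by case: unliftP gh => [k -> //|->]; rewrite eqxx.
  by apply/eqP/ffunP => h; rewrite !ffunE valK.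
apply/ffunP=> h; rewrite ffunE; case: insubP => [h' _ <-|gh]; first by rewrite ffunE.
by rewrite rg // liftK.
Qed.

Lemma delete_vertexE n e (g : pregraph n.+2 e) x :
  delete_vertex g x = (-1) ^+ lift_perm x ord_max 1%g *:
    \sum_(g' | reconnects g x g') gen g'.
Proof. by rewrite -sum_reconnect. Qed.

Lemma delete_permute_vertices n e (s : 'S_n.+2) (g : pregraph n.+2 e) :
  delete_graph (permute_vertices s g) - (-1) ^+ s *: delete_graph g
    \in relations n.+1 e.
Proof.
rewrite /delete_graph [X in X - _](reindex_inj (@perm_inj _ s)) /=.
rewrite scaler_sumr -sumrB memv_suml // => x _.
rewrite valence_permute_vertices scalerA mulrC -scalerA -scalerBr rpredZ //.
rewrite !delete_vertexE.
have [s' ->] : exists s', s = lift_perm x (s x) s'.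
  have inj : injective (fun k => odflt k (unlift (s x) (s (lift x k)))).
    move=> k l; have ne m : s x != s (lift x m).
      by rewrite (inj_eq perm_inj) neq_lift.
    have [k1 e1 ->] := unlift_some (ne k); have [l1 e2 ->] := unlift_some (ne l).
    by move=> /= kl; move: e1; rewrite kl -e2 => /perm_inj/lift_inj.
  exists (perm inj); apply/permP=> y.
  case: (unliftP x y) => [k|] ->; last by rewrite lift_perm_id.
  rewrite lift_perm_lift permE.
  have ne : s x != s (lift x k) by rewrite (inj_eq perm_inj) neq_lift.
  by have [k1 e1 ->] := unlift_some ne.
rewrite lift_perm_id.
rewrite [X in _ *: X - _](reindex_inj (can_inj (permute_verticesK s'))) /=.
under eq_bigl => g'.
  have -> : reconnects (permute_vertices (lift_perm x (s x) s') g) (s x)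
      (permute_vertices s' g') = reconnects g x g'.
    apply: eq_forallb => h; rewrite !ffunE -(lift_perm_lift x (s x)).
    by rewrite -{2}(lift_perm_id x (s x) s') !(inj_eq perm_inj).
  over.
rewrite scalerA -signr_addb !odd_lift_perm odd_perm1 addbF.
have -> : odd x (+) odd (s x) (+) s' (+) (odd x (+) odd (@ord_max n.+1) (+) false)
   = (odd (s x) (+) odd (@ord_max n.+1)) (+) s'.
  by case: (odd x); case: (odd (s x)); case: (odd_perm s'); case: (odd _).
rewrite [X in _ - X *: _]signr_addb -scalerA -scalerBr rpredZ // scaler_sumr -sumrB.
by rewrite memv_suml // => g' _; apply: relation_permute_vertices.
Qed.

Lemma delete_permute_edges n e (t : 'S_e) (g : pregraph n.+2 e) :
  delete_graph (permute_edges t g) - delete_graph g \in relations n.+1 e.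
Proof.
rewrite /delete_graph -sumrB memv_suml // => x _.
rewrite valence_permute_edges -scalerBr rpredZ // !delete_vertexE.
rewrite -scalerBr rpredZ //.
rewrite [X in X - _](reindex_inj (can_inj (permute_edgesK t))) /=.
under eq_bigl => g'.
  have -> : reconnects (permute_edges t g) x (permute_edges t g')
      = reconnects g x g'.
    apply/forallP/forallP => rg [j b]; last by rewrite !ffunE.
    by have := rg (t^-1%g j, b); rewrite !ffunE /= permKV.
  over.
by rewrite -sumrB memv_suml // => g' _; apply: relation_permute_edges.
Qed.

Lemma delete_reverse_edge n e (j : 'I_e) (g : pregraph n.+2 e) :
  delete_graph (reverse_edge j g) + delete_graph g \in relations n.+1 e.
Proof.
rewrite /delete_graph -big_split memv_suml //= => x _.
rewrite valence_reverse_edge -scalerDr rpredZ // !delete_vertexE.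
rewrite -scalerDr rpredZ //.
rewrite [X in X + _](reindex_inj (inv_inj (@reverse_edgeK n.+1 e j))) /=.
under eq_bigl => g'.
  have -> : reconnects (reverse_edge j g) x (reverse_edge j g')
      = reconnects g x g'.
    apply/forallP/forallP => rg [k b]; last by rewrite !ffunE.
    by have := rg (k, (k == j) (+) b); rewrite !ffunE /= addbA addbb.
  over.
by rewrite -big_split memv_suml //= => g' _; apply: relation_reverse_edge.
Qed.

Lemma delete_chain_relations n e :
  {in relations n.+2 e, forall c, @delete_chain n e c \in relations n.+1 e}.
Proof.
have gen_delete (G : graph i n.+2 e) : delete_chain (gen (val G)) = delete_graph (val G)
    :> chain n.+1 e.
  by rewrite gen_val delete_chain_delta.
have gen_delete' g : tadpole_free g && min_valence i g ->
    delete_chain (gen g) = delete_graph g :> chain n.+1 e.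
  by move=> Gg; rewrite -(gen_delete (Sub g Gg : graph i n.+2 e)).
pose D : 'Hom(chain n.+2 e, chain n.+1 e) := linfun (@delete_chain n e).
suff sub : (relations n.+2 e <= D @^-1: relations n.+1 e)%VS.
  by move=> c /(subvP sub); rewrite -memv_preim lfunE.
rewrite !subv_add -andbA; apply/and3P; split; apply/subv_sumP => G _;
  apply/subv_sumP => p _; rewrite -memvE -memv_preim lfunE /=;
  have GG := valP G.
- rewrite linearB linearZ /= gen_delete gen_delete' ?delete_permute_vertices //.
  by rewrite tadpole_free_permute_vertices min_valence_permute_vertices.
- rewrite linearB /= gen_delete gen_delete' ?delete_permute_edges //.
  by rewrite tadpole_free_permute_edges min_valence_permute_edges.
- rewrite linearD /= gen_delete gen_delete' ?delete_reverse_edge //.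
  by rewrite tadpole_free_reverse_edge min_valence_reverse_edge.
Qed.

Definition fGC0 : fGC := fun n e => 0.

(* Graphs with one vertex are mapped to zero: they contribute to no component *)
(* of fGC_D x.                                                                *)
Definition fGC_D (x : fGC) : fGC := fun n e =>
  vquot_map (relations n.+1 e) (@delete_chain n e) (x n.+1 e).

Lemma fGC_D_pi n e (x : fGC) (c : chain n.+2 e) :
  x n.+1 e = vquot_pi _ c -> fGC_D x n e = vquot_pi _ (delete_chain c).
Proof.
by move=> xc; rewrite /fGC_D xc vquot_mapE //; apply: delete_chain_relations.
Qed.

End GraphComplex.

Arguments fGC0 {K i}.

(* Main.v *)
Require Import Defs.
From mathcomp Require Import all_boot all_order perm all_algebra.
From Stdlib Require Import FunctionalExtensionality.

(** Deleting [x] and then [y] from a graph [g] gives a signed sum over pairs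
    [(g1, g2)]: the edge-ends at [x] are first moved to the other vertices,
    giving [g1], then those now at [y] are moved on, giving [g2], and the sign
    contains [(-1)] to the valence of [y] in [g1].  Such a sum vanishes modulo
    the relations already for each single pair [(x, y)].

    All vertices of [g] being at least 1-valent, there is an edge-end [h] at
    [x].  Let [z] be the other vertex of its edge.

    - If [z <> y], then [h] can reach its place in [g2] in two ways: directly,
      or with a stop at [y].  Neither way creates a tadpole in [g1], since the
      edge of [h] is not a tadpole in [g2], and the two ways give opposite signs
      to the same [g2], because they change the valence of [y] by one
      ([detour_admissible], [detour_sign]).

    - If [z = y], then both ends of the edge of [h] are free in [g2], while in
      [g1] the end [h] cannot stop at [y] without creating a tadpole.
      Interchanging the two ends in [g2] is therefore a symmetry of the sum that
      keeps the sign and changes the graph by the reversal of one edge, hence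
      by the factor [-1] ([swap_admissible], [swap_sign]).

    In both cases an involution on the pairs carries each term to its opposite
    modulo the relations, so that twice the sum is a relation
    ([memv_sum_involution]), and 2 is invertible in [K]. *)

Set Implicit Arguments.
Unset Strict Implicit.
Unset Printing Implicit Defensive.

Import GRing.Theory.
Local Open Scope ring_scope.

Lemma memv_sum_involution (K : fieldType) (V : vectType K) (U : {vspace V})
    (I : finType) (P : pred I) (F : I -> V) (f : I -> I) :
  (2%:R : K) != 0 ->
  {in P, forall p, P (f p)} -> {in P, cancel f f} ->
  {in P, forall p, F p + F (f p) \in U} ->
  \sum_(p | P p) F p \in U.
Proof.
move=> nz2 Pf fK FU.
have twice : \sum_(p | P p) F p + \sum_(p | P p) F p \in U.
  have {2}-> : \sum_(p | P p) F p = \sum_(p | P p) F (f p).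
    rewrite (reindex_onto f f) => [|p /fK //].
    apply: eq_bigl => p; apply/andP/idP => [[Pfp /eqP fpK]|Pp].
      by rewrite -fpK; apply: Pf.
    by rewrite (Pf p Pp) (fK p Pp).
  by rewrite -big_split memv_suml //= => p Pp; apply: FU.
by move: twice; rewrite -mulr2n -scaler_nat rpredZeq (negPf nz2).
Qed.

(** * Edge-ends *)

Definition opposite e (h : halfedge e) : halfedge e := (h.1, ~~ h.2).

Lemma opposite_neq e (h : halfedge e) : opposite h != h.
Proof. by case: h => j b; rewrite xpair_eqE eqxx /=; case: b. Qed.

Lemma oppositeK e : involutive (@opposite e).
Proof. by case=> j b; rewrite /opposite /= negbK. Qed.

Lemma tadpole_freeP n e (g : pregraph n e) :
  reflect (forall h, g (opposite h) != g h) (tadpole_free g).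
Proof.
apply: (iffP forallP) => [tg [j b]|tg j]; last exact: (tg (j, true)).
by have := tg j; case: b => //=; rewrite eq_sym.
Qed.

Lemma reverse_edgeE n e (h k : halfedge e) (g : pregraph n e) :
  reverse_edge h.1 g k =
  if (k == h) || (k == opposite h) then g (opposite k) else g k.
Proof.
case: h k => j b [l c]; rewrite ffunE /opposite /= !xpair_eqE.
by case: eqVneq => //= ->; case: b c => -[].
Qed.

Definition move_end n e (h : halfedge e) (z : 'I_n) (g : pregraph n e)
    : pregraph n e :=
  [ffun k => if k == h then z else g k].

Lemma move_end_id n e (h : halfedge e) (g : pregraph n e) :
  move_end h (g h) g = g.
Proof. by apply/ffunP=> k; rewrite ffunE; case: eqP => [->|]. Qed.

Lemma move_endK n e (h : halfedge e) z w (g : pregraph n e) :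
  move_end h z (move_end h w g) = move_end h z g.
Proof. by apply/ffunP=> k; rewrite !ffunE; case: eqP. Qed.

Lemma valence_move_end n e (h : halfedge e) z (g : pregraph n e) y :
  (valence (move_end h z g) y + (g h == y) = valence g y + (z == y))%N.
Proof.
rewrite /valence [in LHS](cardsD1 h) [in RHS](cardsD1 h) !inE ffunE eqxx.
rewrite addnC addnA [RHS]addnAC; congr (_ + _ + _)%N.
apply: eq_card => k; rewrite !inE ffunE.
by case: (k == h).
Qed.

Lemma tadpole_free_move_end n e (h : halfedge e) z (g : pregraph n e) :
  tadpole_free g -> g (opposite h) != z -> tadpole_free (move_end h z g).
Proof.
move=> /tadpole_freeP tg hz; apply/tadpole_freeP => k; rewrite !ffunE.
have [->|kh] := eqVneq k h; first by rewrite (negPf (opposite_neq h)).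
have [kh'|_] := eqVneq (opposite k) h; last exact: tg.
by rewrite eq_sym -[k]oppositeK kh'.
Qed.

Lemma reconnects_move_end n e (g : pregraph n.+2 e) g1 h z :
  reconnects g (g h) g1 -> reconnects g (g h) (move_end h z g1).
Proof.
move=> /reconnectsP rg; apply/reconnectsP => k kx; rewrite ffunE.
by case: (eqVneq k h) kx => [->|_ /rg //]; rewrite eqxx.
Qed.

Lemma min_valence_reconnects i n e (g : pregraph n.+2 e) x g1 :
  min_valence i g -> reconnects g x g1 -> min_valence i g1.
Proof.
move=> /forallP vg /reconnectsP rg; apply/forallP => k.
apply: leq_trans (vg (lift x k)) _.
apply/subset_leq_card/subsetP => h; rewrite !inE => /eqP gh.
have /rg : g h != x by rewrite gh eq_sym neq_lift.
by rewrite gh => /lift_inj ->.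
Qed.

(** * Deleting two vertices *)

Section TwoVertices.
Variables (n e : nat) (g : pregraph n.+3 e) (h : halfedge e) (y : 'I_n.+2).
Hypothesis tg : tadpole_free g.
Let x : 'I_n.+3 := g h.

(** The second vertex to be deleted is [lift x y] in [g] and [y] in [p.1]. *)
Definition admissible (p : pregraph n.+2 e * pregraph n.+1 e) : bool :=
  [&& reconnects g x p.1, tadpole_free p.1, reconnects p.1 y p.2
    & tadpole_free p.2].

(** In an admissible pair [h] is in [p.1] either at [y] or already at its final
    place [lift y (p.2 h)]; these two positions are exchanged. *)
Definition detour (p : pregraph n.+2 e * pregraph n.+1 e) :=
  (move_end h (if p.1 h == y then lift y (p.2 h) else y) p.1, p.2).

(** The second graph gets the ends of the edge of [h] interchanged; [h] has to
    sit at its new final place already in the first graph. *)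
Definition swap_ends (p : pregraph n.+2 e * pregraph n.+1 e) :=
  (move_end h (lift y (p.2 (opposite h))) p.1, reverse_edge h.1 p.2).

(** The edge of [h] is not a tadpole, so its other end survives the first
    deletion unmoved. *)
Lemma opposite_reconnect g1 :
  reconnects g x g1 -> g (opposite h) = lift x (g1 (opposite h)).
Proof. by move=> /reconnectsP; apply; apply: (tadpole_freeP _ tg). Qed.

Lemma detour_admissible p :
  g (opposite h) != lift x y -> admissible p -> admissible (detour p).
Proof.
case: p => g1 g2 hy /and4P[/= rg tg1 rg1 tg2].
have oy : g1 (opposite h) != y.
  by apply: contraNneq hy => <-; rewrite -opposite_reconnect.
have oE := reconnectsP _ _ _ rg1 _ oy.
apply/and4P; split=> //=; first exact: reconnects_move_end.
  apply: tadpole_free_move_end => //; case: ifP => // _.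
  by rewrite oE (inj_eq lift_inj); apply: (tadpole_freeP _ tg2).
apply/reconnectsP => k; rewrite ffunE; case: (eqVneq k h) => [->|_].
  by case: ifP => //; rewrite eqxx.
exact: (reconnectsP _ _ _ rg1).
Qed.

Lemma detourK p : admissible p -> detour (detour p) = p.
Proof.
case: p => g1 g2 /and4P[/= _ _ /reconnectsP rg1 _]; rewrite /detour /=.
rewrite move_endK ffunE eqxx -[X in _ = (X, _)](move_end_id h).
have [->|hy] := eqVneq (g1 h) y; last by rewrite eqxx -rg1.
by rewrite eq_sym (negPf (neq_lift _ _)).
Qed.

Lemma detour_sign (K : fieldType) p :
  (-1) ^+ valence (detour p).1 y = - (-1) ^+ valence p.1 y :> K.
Proof.
rewrite -signr_odd -[in RHS]signr_odd -signrN; congr (_ ^+ nat_of_bool _).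
have := congr1 odd (valence_move_end h
  (if p.1 h == y then lift y (p.2 h) else y) p.1 y).
rewrite /detour !oddD /= => /(canRL (addbK _)) ->.
case: (eqVneq (p.1 h)) => _; last by rewrite eqxx addbF addbT.
by rewrite eq_sym (negPf (neq_lift _ _)) addbF addbT.
Qed.

Lemma swap_admissible p :
  g (opposite h) = lift x y -> admissible p -> admissible (swap_ends p).
Proof.
case: p => g1 g2 hy /and4P[/= rg tg1 rg1 tg2].
have oy : g1 (opposite h) = y.
  by apply: (@lift_inj _ x); rewrite -opposite_reconnect.
apply/and4P; split=> /=; last by rewrite tadpole_free_reverse_edge.
- exact: reconnects_move_end.
- by apply: tadpole_free_move_end => //; rewrite oy neq_lift.
apply/reconnectsP => k; rewrite ffunE reverse_edgeE.
have [->|_] := eqVneq k h; first by [].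
have [->|_] := eqVneq k (opposite h); first by rewrite oy eqxx.
exact: (reconnectsP _ _ _ rg1).
Qed.

(** Stopping at [y] would turn the edge of [h] into a tadpole. *)
Lemma end_off g1 :
  g (opposite h) = lift x y -> reconnects g x g1 -> tadpole_free g1 ->
  g1 h != y.
Proof.
move=> hy rg /tadpole_freeP/(_ h); apply: contraNneq => ->; apply/eqP.
by apply: (@lift_inj _ x); rewrite -opposite_reconnect.
Qed.

Lemma swapK p :
  g (opposite h) = lift x y -> admissible p -> swap_ends (swap_ends p) = p.
Proof.
case: p => g1 g2 hy /and4P[/= rg tg1 /reconnectsP rg1 _].
rewrite /swap_ends /= reverse_edgeK move_endK reverse_edgeE eqxx orbT oppositeK.
by rewrite -rg1 ?move_end_id ?end_off.
Qed.

Lemma swap_sign p :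
  g (opposite h) = lift x y -> admissible p ->
  valence (swap_ends p).1 y = valence p.1 y.
Proof.
case: p => g1 g2 hy /and4P[/= rg tg1 _ _].
have := valence_move_end h (lift y (g2 (opposite h))) g1 y.
by rewrite (negPf (end_off _ _ _)) // [lift _ _ == _]eq_sym
           (negPf (neq_lift _ _)) !addn0.
Qed.

(** The two cases for the vertex joined to [g h]: either the terms with and
    without a detour of [h] over [y] cancel, or reversing the edge of [h]
    gives the opposite sum. *)
Lemma sum_admissible_relations (K : fieldType) (i : nat) :
  (2%:R : K) != 0 ->
  \sum_(p | admissible p) (-1) ^+ valence p.1 y *: gen K i p.2
    \in relations K i n.+1 e.
Proof.
move=> nz2; have [hy|hy] := eqVneq (g (opposite h)) (lift x y).
  apply: (memv_sum_involution (f := swap_ends)) => // p Pp.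
  - exact: swap_admissible.
  - exact: swapK.
  by rewrite swap_sign // -scalerDr rpredZ // addrC relation_reverse_edge.
apply: (memv_sum_involution (f := detour)) => // p Pp.
- exact: detour_admissible.
- exact: detourK.
by rewrite detour_sign scaleNr addrN mem0v.
Qed.

End TwoVertices.

(** * The square of the deletion *)

Section Square.
Variables (K : fieldType) (i : nat).

Lemma delete_chain_gen n e (g : pregraph n.+2 e) :
  min_valence i g ->
  delete_chain (gen K i g) = if tadpole_free g then delete_graph K i g else 0.
Proof.
move=> vg; case: ifP => tg; last by rewrite gen_out ?tg // raddf0.
have Gg : tadpole_free g && min_valence i g by rewrite tg.
by rewrite -[g]/(val (Sub g Gg : graph i n.+2 e)) gen_val delete_chain_delta.
Qed.

(** Reconnecting never lowers a valence, so that of the conditions on the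
    intermediate graph only the absence of tadpoles remains. *)
Lemma delete_delete_vertex n e (g : pregraph n.+3 e) x :
  min_valence i g ->
  delete_chain (delete_vertex K i g x) = (-1) ^+ lift_perm x ord_max 1%g *:
    \sum_y (-1) ^+ lift_perm y ord_max 1%g *:
      \sum_(g1 | reconnects g x g1 && tadpole_free g1)
        \sum_(g2 | reconnects g1 y g2) (-1) ^+ valence g1 y *: gen K i g2.
Proof.
move=> vg; rewrite delete_vertexE linearZ linear_sum /=; congr (_ *: _).
under eq_bigr => g1 rg do
  rewrite delete_chain_gen ?(min_valence_reconnects vg rg) //.
rewrite -big_mkcondr /=; under [RHS]eq_bigr => y _ do rewrite scaler_sumr.
rewrite exchange_big /=; apply: eq_bigr => g1 _; apply: eq_bigr => y _.
rewrite delete_vertexE scalerA mulrC -scalerA; congr (_ *: _).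
exact: scaler_sumr.
Qed.

Lemma delete_delete_vertex_relations n e (g : pregraph n.+3 e) h :
  (2%:R : K) != 0 -> tadpole_free g -> min_valence i g ->
  delete_chain (delete_vertex K i g (g h)) \in relations K i n.+1 e.
Proof.
move=> nz2 tg vg; rewrite delete_delete_vertex // rpredZ // memv_suml // => y _.
rewrite rpredZ // pair_big_dep /=.
apply: etrans (sum_admissible_relations h y tg i nz2).
apply: (congr1 (fun c => c \in relations K i n.+1 e)).
(* The graphs [g2] with a tadpole contribute [gen g2 = 0]. *)
rewrite [LHS](bigID (fun p => tadpole_free p.2)) /=.
rewrite [X in _ + X]big1 => [|p /andP[_ Np]].
  by rewrite addr0; apply: eq_bigl => p; rewrite /admissible -!andbA.
by rewrite gen_out ?scaler0 // (negPf Np).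
Qed.

(** This is where positive valences enter: each deleted vertex [x] must carry
    some edge-end [h] to start the cancellation from. *)
Lemma delete_delete_relations n e (c : chain K i n.+3 e) :
  (0 < i)%N -> (2%:R : K) != 0 ->
  delete_chain (delete_chain c) \in relations K i n.+1 e.
Proof.
move=> i_gt0 nz2; rewrite [X in delete_chain X]/delete_chain linear_sum /=.
rewrite memv_suml // => G _; rewrite linearZ rpredZ // /delete_graph /=.
rewrite linear_sum memv_suml // => x _; rewrite linearZ rpredZ //=.
have /andP[tg vg] := valP G.
have : (0 < valence (val G) x)%N by exact: leq_trans (forallP vg x).
case/card_gt0P => h; rewrite inE => /eqP <-.
exact: delete_delete_vertex_relations.
Qed.

End Square.

Theorem proposition3p6 (K : fieldType) (charK : [pchar K]%R =i pred0)
  (x : fGC K 1) : fGC_D (fGC_D x) = fGC0.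
Proof.
have nz2 : (2%:R : K) != 0 by rewrite ((pcharf0P K).1 charK).
apply: functional_extensionality_dep => n.
apply: functional_extensionality_dep => e.
have Dx : fGC_D x n.+1 e = vquot_pi _ (delete_chain (vquot_repr (x n.+2 e))).
  by apply: fGC_D_pi; rewrite vquot_reprK.
rewrite (fGC_D_pi Dx) /fGC0 -(raddf0 (vquot_pi (relations K 1 n.+1 e))).
by apply/vquot_eqP; rewrite subr0 delete_delete_relations.
Qed.
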